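(* Let $k\ge 1$ and $p\ge 2k$ be integers such that the Kneser graph $KG_{p,k}$ is connected. Then $$S_1(KG_{p,k})=2\,W(KG_{p,k})\binom{p-k}{k}$$ and $$S_2(KG_{p,k})=\binom{p-k}{k}\cdot\frac{2\,(W(KG_{p,k}))^2}{\binom{p}{k}}.$$
   Context: The Kneser graph $KG_{p,k}$ has as vertices the $k$-element subsets of a set of $p$ elements, two vertices being adjacent if and only if the corresponding subsets are disjoint. For a finite connected simple graph $G$, $d_G(u,v)$ is the shortest-path distance, $\sigma_G(u)=\sum_{v\in V(G)}d_G(u,v)$ is the status of $u$, and $W(G)=\sum_{\{u,v\}\subseteq V(G)}d_G(u,v)$ is the Wiener index. The status connectivity indices are $S_1(G)=\sum_{uv\in E(G)}[\sigma_G(u)+\sigma_G(v)]$ and $S_2(G)=\sum_{uv\in E(G)}\sigma_G(u)\sigma_G(v)$. *)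

(* Defs.v *)
From mathcomp Require Import all_boot all_order all_algebra.

Set Implicit Arguments.
Unset Strict Implicit.
Unset Printing Implicit Defensive.

(* A finite simple graph is given by its vertex type [T : finType] and a
   symmetric irreflexive adjacency relation [e : rel T]. *)
Section Graph.
Variables (T : finType) (e : rel T).
Implicit Types u v : T.

Definition graph_connected : Prop := forall u v, connect e u v.

Definition walk (n : nat) u v : bool :=
  [exists s : n.-tuple T, path e u s && (last u s == v)].

(* The least [n < #|T|] for which there is a walk of length [n] from [u] to
   [v]; the value is [#|T|] when [v] is not reachable from [u]. *)
Definition dist u v : nat := find (fun n => walk n u v) (iota 0 #|T|).

Definition status u : nat := \sum_(v : T) dist u v.

(* Selects exactly one of (u, v) and (v, u) when u != v, and never (u, u):
   summing over the pairs such that [upair u v] is summing over the unordered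
   pairs {u, v} of distinct vertices. *)
Definition upair u v : bool := (enum_rank u < enum_rank v)%N.

Definition wiener : nat := \sum_(u : T) \sum_(v : T | upair u v) dist u v.

Definition S1_index : nat :=
  \sum_(u : T) \sum_(v : T | upair u v && e u v) (status u + status v).

Definition S2_index : nat :=
  \sum_(u : T) \sum_(v : T | upair u v && e u v) status u * status v.

Lemma distP u v : connect e u v ->
  walk (dist u v) u v /\ forall n, walk n u v -> (dist u v <= n)%N.
Proof.
move=> /connectP[s0 es0 ->]; case/shortenP: es0 => s es us _ {s0}.
set w := last u s.
have ws : walk (size s) u w.
  by apply/existsP; exists (in_tuple s); rewrite es eqxx.
have lts : (size s < #|T|)%N.
  by change (size (u :: s) <= #|T|)%N; rewrite -(card_uniqP us) max_card.
have hasw : has (fun n => walk n u w) (iota 0 #|T|).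
  by apply/hasP; exists (size s); rewrite // mem_iota.
split.
  move: (nth_find 0 hasw); rewrite nth_iota ?add0n //.
  by move: hasw; rewrite has_find size_iota.
move=> n wn; rewrite leqNgt; apply/negP => ltn.
move: (before_find 0 ltn); rewrite nth_iota ?add0n ?wn //.
by apply: leq_trans ltn _; rewrite /dist -[X in (_ <= X)%N](size_iota 0) find_size.
Qed.

End Graph.

Notation kneser_vertex p k := {A : {set 'I_p} | #|A| == k}.

Definition kneser (p k : nat) : rel (kneser_vertex p k) :=
  fun A B => [disjoint val A & val B].

Lemma kneser_sym p k : symmetric (@kneser p k).
Proof. by move=> A B; rewrite /kneser disjoint_sym. Qed.

Lemma kneser_irrefl p k : (0 < k)%N -> irreflexive (@kneser p k).
Proof.
move=> k0 A; apply/negbTE; rewrite /kneser -setI_eq0 setIid -cards_eq0.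
by rewrite (eqP (valP A)) -lt0n.
Qed.

(* Main.v *)
Require Import Defs.
From mathcomp Require Import all_boot all_order all_algebra.
From mathcomp Require Import all_fingroup all_solvable.

(** Permutations of the ground set act transitively on the vertices of the
    Kneser graph by automorphisms, so every vertex has the same status [s].
    With [N] vertices of degree [d], double counting ordered pairs gives
    [2 W = N s], [2 S1 = N d (2 s)] and [2 S2 = N d s^2]; eliminating [s]
    yields both identities. *)

Set Implicit Arguments.
Unset Strict Implicit.
Unset Printing Implicit Defensive.

Section Graph.
Variables (T : finType) (e : rel T).
Implicit Types u v : T.

(** Each row splits by comparing ranks: [v] after [u], [v] before [u], and [v = u]. Exchanging the
    two summations turns the second part into the first, by symmetry of [F]. *)
Lemma sum_upair (F : T -> T -> nat) : (forall u v, F u v = F v u) ->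
  (\sum_u \sum_v F u v = 2 * (\sum_u \sum_(v | upair u v) F u v) + \sum_u F u u)%N.
Proof.
move=> Fsym.
have split_row u : (\sum_v F u v = \sum_(v | upair u v) F u v
    + \sum_(v | upair v u) F u v + F u u)%N.
  rewrite (bigID (upair u)) /= -addnA; congr addn.
  rewrite (bigD1 u) /=; last by rewrite /upair ltnn.
  rewrite addnC; congr addn; apply: eq_bigl => v.
  rewrite /upair -leqNgt [RHS]ltn_neqAle andbC; congr andb.
  by rewrite -(inj_eq enum_rank_inj).
rewrite (eq_bigr _ (fun u _ => split_row u)) !big_split /= mul2n -addnn.
congr (_ + _ + _)%N.
rewrite (exchange_big_dep xpredT) //=; apply: eq_bigr => u _.
by apply: eq_bigr => v _; rewrite Fsym.
Qed.

(** Setting [F] to 0 off the edges keeps it symmetric, so [sum_upair] applies; irreflexivity makes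
    the diagonal vanish. *)
Lemma sum_edges (F : T -> T -> nat) :
  symmetric e -> irreflexive e -> (forall u v, F u v = F v u) ->
  (\sum_u \sum_(v | e u v) F u v
    = 2 * \sum_u \sum_(v | upair u v && e u v) F u v)%N.
Proof.
move=> esym eirr Fsym.
under eq_bigr => u _ do rewrite big_mkcond.
rewrite sum_upair; last by move=> u v; rewrite esym Fsym.
rewrite [X in (_ + X)%N]big1 ?addn0; last by move=> u _; rewrite eirr.
by under [in RHS]eq_bigr => u _ do rewrite big_mkcondr.
Qed.

Lemma walk_sym n u v : symmetric e -> walk e n u v = walk e n v u.
Proof.
move=> esym; have imp x y : walk e n x y -> walk e n y x.
  move=> /existsP[s /andP[es /eqP <-]].
  (* A walk lists its vertices without the starting one, so the reversed walk drops the endpoint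
     [last x s] and regains [x]. *)
  apply/existsP; exists (rev_tuple (belast_tuple x s)); apply/andP; split.
    rewrite /= rev_path; move: es; congr is_true; apply: eq_path => a b.
    exact: esym.
  by case: s es => -[|a s] //= _ _; rewrite rev_cons last_rcons.
by apply/idP/idP; apply: imp.
Qed.

Lemma dist_sym u v : symmetric e -> dist e u v = dist e v u.
Proof. by move=> esym; apply: eq_find => n; apply: walk_sym. Qed.

Lemma dist_refl u : dist e u u = 0.
Proof.
have w0 : walk e 0 u u by apply/existsP; exists [tuple]; rewrite /= eqxx.
(* The range of lengths searched by [dist] is nonempty, hence begins with 0. *)
have: (0 < #|T|)%N by apply/card_gt0P; exists u.
by rewrite /dist; case: #|T| => //= n _; rewrite w0.
Qed.

Lemma sum_status : symmetric e -> (\sum_u status e u = 2 * wiener e)%N.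
Proof.
move=> esym; rewrite sum_upair; last by move=> u v; apply: dist_sym.
by rewrite [X in (_ + X)%N]big1 ?addn0 // => u _; apply: dist_refl.
Qed.

Lemma walk_homo (f : T -> T) n u v :
  {homo f : x y / e x y} -> walk e n u v -> walk e n (f u) (f v).
Proof.
move=> fh /existsP[s /andP[es /eqP <-]]; apply/existsP; exists (map_tuple f s).
by rewrite /= last_map eqxx andbT (homo_path fh).
Qed.

(** Reindexing the sum along [f] leaves distances from [f u] to [f v]; these equal those from [u] to
    [v] because walks of each length correspond under [f]. *)
Lemma status_automorphism (f : T -> T) u :
  injective f -> {mono f : x y / e x y} -> status e (f u) = status e u.
Proof.
move=> finj fm; rewrite /status (reindex_inj finj); apply: eq_bigr => v _.
apply: eq_find => n; have [g fK gK] := injF_bij finj.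
apply/idP/idP => [|w]; last by apply: walk_homo w => x y; rewrite fm.
(* Walks are carried back by the inverse [g], which preserves adjacency since [f] reflects it. *)
rewrite -{2}(fK u) -{2}(fK v); apply: walk_homo => x y.
by rewrite -[e (g x) _]fm !gK.
Qed.

Section Regular.
Variables d s : nat.
Hypotheses (esym : symmetric e) (eirr : irreflexive e).
Hypotheses (degE : forall u, #|[pred v | e u v]| = d).
Hypotheses (statE : forall u, status e u = s).

Lemma wiener_const : (2 * wiener e = #|T| * s)%N.
Proof. by rewrite -sum_status // (eq_bigr _ (fun u _ => statE u)) sum_nat_const. Qed.

Lemma sum_edges_const c : (\sum_u \sum_(v | e u v) c = #|T| * (d * c))%N.
Proof.
under eq_bigr => u _ do rewrite sum_nat_const degE.
by rewrite sum_nat_const.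
Qed.

Lemma S1_const : (2 * S1_index e = #|T| * (d * (2 * s)))%N.
Proof.
rewrite -sum_edges //; last by move=> u v; rewrite addnC.
rewrite -sum_edges_const; apply: eq_bigr => u _; apply: eq_bigr => v _.
by rewrite !statE mul2n addnn.
Qed.

Lemma S2_const : (2 * S2_index e = #|T| * (d * s ^ 2))%N.
Proof.
rewrite -sum_edges //; last by move=> u v; rewrite mulnC.
rewrite -sum_edges_const; apply: eq_bigr => u _; apply: eq_bigr => v _.
by rewrite !statE mulnn.
Qed.

Lemma S1_regular : S1_index e = (2 * wiener e * d)%N.
Proof.
apply/eqP; rewrite -(eqn_pmul2l (isT : 0 < 2)%N) S1_const wiener_const.
by rewrite (mulnCA d) !mulnA (mulnC #|T|) -!mulnA (mulnC d).
Qed.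

(** Both sides, doubled, equal [d * (#|T| * s) ^ 2]. The factor [#|T|] stays on the left to avoid
    division in [nat]. *)
Lemma S2_regular : (#|T| * S2_index e = d * (2 * wiener e ^ 2))%N.
Proof.
apply/eqP; rewrite -(eqn_pmul2l (isT : 0 < 2)%N) mulnCA S2_const.
rewrite (mulnCA 2 d) (mulnA 2 2) -(expnMn 2 _ 2) wiener_const.
by rewrite expnMn (mulnCA #|T| d) mulnA -mulnn -!mulnA mulnCA.
Qed.

End Regular.
End Graph.

(** The enumerations of [A] and [B] are tuples of distinct points of the same length, and the
    symmetric group acts transitively on such tuples. *)
Lemma perm_imset_trans (T : finType) (A B : {set T}) :
  #|A| = #|B| -> exists s : {perm T}, s @: A = B.
Proof.
move=> cAB.
have dt (C : {set T}) (cC : size (enum C) == #|A|) :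
    Tuple cC \in #|A|.-dtuple(setT).
  by rewrite inE /= enum_uniq; apply/subsetP => x _; rewrite inE.
have sA : size (enum A) == #|A| by rewrite -cardE.
have sB : size (enum B) == #|A| by rewrite -cardE cAB.
have tr := ntransitive_weak (max_card (mem A)) (Sym_trans T).
have [s _ /(congr1 val) /= enumB] := atransP2 tr (dt _ sA) (dt _ sB).
exists s; apply/setP => x.
by rewrite -[RHS]mem_enum enumB; apply/imsetP/mapP => -[y yA ->];
  exists y => //; rewrite ?mem_enum // -mem_enum.
Qed.

Section Kneser.
Variables p k : nat.
Implicit Types A B : kneser_vertex p k.

Lemma card_kneser_vertex : #|{: kneser_vertex p k}| = 'C(p, k).
Proof.
rewrite card_sig -[in RHS](card_ord p) -(card_draws 'I_p k).
by apply: eq_card => A; rewrite !inE.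
Qed.

(** The neighbours of [A] are the [k]-subsets of its complement, which has [p - k] elements. *)
Lemma kneser_degree A : #|[pred B | kneser A B]| = 'C(p - k, k).
Proof.
have <- : #|~: val A| = (p - k)%N by rewrite cardsCs setCK card_ord (eqP (valP A)).
rewrite -cards_draws -(card_imset _ val_inj); apply: eq_card => B.
rewrite inE; apply/imsetP/andP => [[C CA ->]|[BA kB]].
  by rewrite -disjoints_subset disjoint_sym (valP C).
exists (Sub B kB) => //.
by rewrite inE /kneser disjoint_sym disjoints_subset.
Qed.

Lemma perm_vertex_subproof (s : {perm 'I_p}) A : #|s @: val A| == k.
Proof. by rewrite card_imset ?(valP A) //; apply: perm_inj. Qed.

Definition perm_vertex (s : {perm 'I_p}) A : kneser_vertex p k :=
  Sub (s @: val A) (perm_vertex_subproof s A).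

Lemma perm_vertex_inj s : injective (perm_vertex s).
Proof.
by move=> A B /(congr1 val) /= /(imset_inj (@perm_inj _ s)) /val_inj.
Qed.

Lemma kneser_perm s : {mono perm_vertex s : A B / kneser A B}.
Proof. by move=> A B; rewrite /kneser /= imset_disjoint //; apply: perm_inj. Qed.

(** Both sets have [k] elements, so some permutation of the ground set induces an automorphism
    taking [A] to [B]. *)
Lemma kneser_status A B : status (@kneser p k) A = status (@kneser p k) B.
Proof.
have [s sAB] : exists s : {perm 'I_p}, s @: val A = val B.
  by apply: perm_imset_trans; rewrite (eqP (valP A)) (eqP (valP B)).
have <- : perm_vertex s A = B by apply: val_inj.
by rewrite (status_automorphism _ (@perm_vertex_inj s) (kneser_perm s)).
Qed.

End Kneser.

Theorem proposition3p9 (p k : nat) (hk : (1 <= k)%N) (hp : (2 * k <= p)%N)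
    (hconn : graph_connected (@kneser p k)) :
  S1_index (@kneser p k) = (2 * wiener (@kneser p k) * 'C(p - k, k))%N
  /\ ((S2_index (@kneser p k))%:R =
      'C(p - k, k)%:R *
        (2%:R * (wiener (@kneser p k))%:R ^+ 2 / 'C(p, k)%:R) :> rat)%R.
Proof.
(* Positivity serves twice: it supplies a vertex [A0], whose status is the common value [s], and it
   allows the final division by ['C(p, k)]. *)
have Cgt0 : (0 < 'C(p, k))%N.
  by rewrite bin_gt0 (leq_trans _ hp) // mul2n -addnn leq_addr.
have /card_gt0P[A0 _] : (0 < #|{: kneser_vertex p k}|)%N.
  by rewrite card_kneser_vertex.
have statE A := kneser_status A A0.
have esym := @kneser_sym p k; have eirr := @kneser_irrefl p k hk.
split; first exact: S1_regular esym eirr (@kneser_degree p k) statE.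
have := S2_regular esym eirr (@kneser_degree p k) statE.
rewrite card_kneser_vertex => /(congr1 (fun n => n%:R : rat)%R).
rewrite 3!GRing.natrM GRing.natrX => S2E.
have C0 : ('C(p, k)%:R != 0 :> rat)%R by rewrite Num.Theory.pnatr_eq0 -lt0n.
by rewrite GRing.mulrA -S2E GRing.mulrC GRing.mulKf.
Qed.
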